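(* Let $n,d\ge 1$ be integers and $v$ an indeterminate. Fix an integer $k_0$ with $1\le k_0\le n$, set $$G'=\{E_\alpha,F_\alpha\mid\alpha\in\Phi^+\}\cup\{K_k\mid k\in\{1,\dots,n\}\setminus\{k_0\}\},$$ and fix some (total) ordering of this set. Then the set of all monomials in $G'$, with the factors written in the specified order, of total degree at most $d$ is a basis over $\mathbb{Q}(v)$ of the $q$-Schur algebra $\mathbf{S}(n,d)$.
   Context: $\{\varepsilon_i\}$ is the standard basis of $\mathbb{Z}^n$ with form $(\varepsilon_i,\varepsilon_j)=\delta_{ij}$; $\alpha_j=\varepsilon_j-\varepsilon_{j+1}$; $\Phi^+=\{\varepsilon_i-\varepsilon_j\mid1\le i<j\le n\}$. $\mathbf{U}=\mathbf{U}_v(\mathfrak{gl}_n)$ is the $\mathbb{Q}(v)$-algebra with generators $E_i,F_i$ ($1\le i\le n-1$), $K_i^{\pm1}$ ($1\le i\le n$) and relations: $K_iK_j=K_jK_i$, $K_iK_i^{-1}=K_i^{-1}K_i=1$; $E_iF_j-F_jE_i=\delta_{ij}\frac{K_iK_{i+1}^{-1}-K_i^{-1}K_{i+1}}{v-v^{-1}}$; $K_iE_j=v^{(\varepsilon_i,\alpha_j)}E_jK_i$, $K_iF_j=v^{-(\varepsilon_i,\alpha_j)}F_jK_i$; $E_i^2E_j-(v+v^{-1})E_iE_jE_i+E_jE_i^2=0$ if $|i-j|=1$ and $E_iE_j=E_jE_i$ otherwise; and the same two relations with $F$ in place of $E$. Quantum root vectors (Jimbo): define $X_{i,i+1}=E_i$,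 $X_{i+1,i}=F_i$, and recursively, for $i<k<j$, $X_{ij}=X_{ik}X_{kj}-vX_{kj}X_{ik}$ and $X_{ji}=X_{jk}X_{ki}-v^{-1}X_{ki}X_{jk}$ (independent of the choice of $k$). For $\alpha=\varepsilon_i-\varepsilon_j\in\Phi^+$ put $E_\alpha=X_{ij}$, $F_\alpha=X_{ji}$. The $q$-Schur algebra is $\mathbf{S}(n,d)=\operatorname{End}_{\mathbf{H}}(V^{\otimes d})$, where $V$ is the $\mathbb{Q}(v)$-vector space with basis $v_1,\dots,v_n$ and $\mathbf{H}=\mathbf{H}(\Sigma_d)$ is the Hecke algebra over $\mathbb{Q}(v)$ generated by $T_1,\dots,T_{d-1}$ with the braid relations and $(T_r-v)(T_r+v^{-1})=0$; $T_r$ acts on tensor places $r,r+1$ by $v_a\otimes v_a\mapsto v\,v_a\otimes v_a$; $v_a\otimes v_b\mapsto v_b\otimes v_a$ if $a<b$; $v_a\otimes v_b\mapsto v_b\otimes v_a+(v-v^{-1})v_a\otimes v_b$ if $a>b$. $\mathbf{U}$ acts on $V$ by $E_iv_b=\delta_{b,i+1}v_i$, $F_iv_b=\delta_{b,i}v_{i+1}$, $K_iv_b=v^{\delta_{ib}}v_b$, and on $V^{\otimes d}$ via the coproduct $\Delta(K_i)=K_i\otimes K_i$, $\Delta(E_i)=E_i\otimes K_iK_{i+1}^{-1}+1\otimes E_i$, $\Delta(F_i)=F_i\otimes1+K_i^{-1}K_{i+1}\otimes F_i$. This action commutes with $\mathbf{H}$ and gives a surjective homomorphism $\mathbf{U}\to\mathbf{S}(n,d)$;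 elements of $\mathbf{U}$ are identified with their images in $\mathbf{S}(n,d)$. *)

(* Defs.v *)
From HB Require Import structures.
From mathcomp Require Import all_boot all_order all_algebra all_fingroup.
From mathcomp Require Import zify.

Set Implicit Arguments.
Unset Strict Implicit.
Unset Printing Implicit Defensive.

Import GRing.Theory.
Local Open Scope ring_scope.

(* Everything is set up over a field K with a parameter v; Q(v) and its
   indeterminate are Qv and indet.  Indices are 0-based: tensor places are
   'I_d, basis vectors of V are 'I_n, and the generators E_i, F_i are indexed
   by the naturals i with i + 1 < n.  Elements of U enter only through their
   images in S(n,d), that is, as endomorphisms of the tensor power. *)

Section Brackets.
Variables (K : fieldType) (W : vectType K).
Implicit Types (f g h : 'End(W)) (q : K).

Definition qbracket q f g : 'End(W) := ((f \o g) - q *: (g \o f))%VF.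

Lemma qbracketE q f g x : qbracket q f g x = f (g x) - q *: g (f x).
Proof. by rewrite !(add_lfunE, opp_lfunE, scale_lfunE, comp_lfunE). Qed.

Lemma qbracketA q f g h : (f \o h = h \o f)%VF ->
  qbracket q f (qbracket q g h) = qbracket q (qbracket q f g) h.
Proof.
move=> fh; apply/lfunP => x; have fhx y : f (h y) = h (f y).
  by rewrite -!comp_lfunE fh.
by rewrite !qbracketE !linearB !linearZ /= !fhx addrACA.
Qed.

Lemma qbracket_comm q f g h : (f \o g = g \o f)%VF -> (f \o h = h \o f)%VF ->
  (f \o qbracket q g h = qbracket q g h \o f)%VF.
Proof.
move=> fg fh; apply/lfunP => x.
have fgx y : f (g y) = g (f y) by rewrite -!comp_lfunE fg.
have fhx y : f (h y) = h (f y) by rewrite -!comp_lfunE fh.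
by rewrite !comp_lfunE !qbracketE linearB linearZ /= !(fgx, fhx).
Qed.

Definition commutator g f : 'End(W) := ((g \o f) - (f \o g))%VF.

Fact commutator_is_linear g : linear (commutator g).
Proof.
move=> a f h; apply/lfunP => x.
rewrite !(add_lfunE, opp_lfunE, scale_lfunE, comp_lfunE) linearP.
by rewrite scalerBr opprD addrACA.
Qed.

HB.instance Definition _ g :=
  GRing.isLinear.Build K 'End(W) 'End(W) _ (commutator g)
    (commutator_is_linear g).

Lemma commutator_eq0 g f : (linfun (commutator g) f == 0) = (g \o f == f \o g)%VF.
Proof. by rewrite lfunE /= subr_eq0. Qed.

End Brackets.

Section TensorSpace.
Variables (K : fieldType) (n d : nat).

Definition word := {ffun 'I_d -> 'I_n}.

(* The d-th tensor power of V, in coordinates: the word w stands for the basis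
   vector v_(w 0) (x) ... (x) v_(w (d-1)). *)
Definition tensor := {ffun word -> K^o}.

Definition evec (w : word) : tensor := [ffun u => (u == w)%:R].

Definition extend_fun (f : word -> tensor) (x : tensor) : tensor :=
  \sum_w (x w : K) *: f w.

Fact extend_fun_is_linear f : linear (extend_fun f).
Proof.
move=> a x y; rewrite /extend_fun scaler_sumr -big_split /=.
by apply: eq_bigr => w _; rewrite !ffunE scalerDl scalerA.
Qed.

HB.instance Definition _ f :=
  GRing.isLinear.Build K tensor tensor _ (extend_fun f)
    (extend_fun_is_linear f).

Definition extend (f : word -> tensor) : 'End(tensor) := linfun (extend_fun f).

Lemma extendE f w : extend f (evec w) = f w.
Proof.
rewrite lfunE /= /extend_fun (bigD1 w) //= ffunE eqxx scale1r.
by rewrite big1 ?addr0 // => u /negPf uw; rewrite ffunE uw scale0r.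
Qed.

Lemma evec_eq (f g : 'End(tensor)) :
  (forall w, f (evec w) = g (evec w)) -> f = g.
Proof.
move=> fg; apply/lfunP => x.
have -> : x = \sum_w (x w : K) *: evec w.
  apply/ffunP => u; rewrite sum_ffunE (bigD1 u) //= !ffunE eqxx.
  rewrite /GRing.scale /= mulr1 big1 ?addr0 // => w wu.
  by rewrite !ffunE eq_sym (negPf wu) /GRing.scale /= mulr0.
by rewrite !linear_sum; apply: eq_bigr => w _; rewrite !linearZ /= fg.
Qed.

(* f_0 (x) ... (x) f_(d-1), for f_s acting on V through column vectors. *)
Definition tensor_op (f : 'I_d -> 'M[K]_n) : 'End(tensor) :=
  extend (fun w => [ffun u : word => \prod_s f s (u s) (w s)]).

Lemma tensor_opM (f g : 'I_d -> 'M[K]_n) :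
  (tensor_op f \o tensor_op g)%VF = tensor_op (fun s => f s *m g s).
Proof.
apply: evec_eq => w; rewrite comp_lfunE !extendE lfunE /= /extend_fun.
apply/ffunP => u; rewrite sum_ffunE ffunE.
under [RHS]eq_bigr do rewrite mxE.
rewrite bigA_distr_bigA /=; apply: eq_bigr => t _.
rewrite !ffunE /GRing.scale /= -big_split.
by apply: eq_bigr => s _; rewrite mulrC.
Qed.

Lemma eq_tensor_op (f g : 'I_d -> 'M[K]_n) : f =1 g -> tensor_op f = tensor_op g.
Proof.
move=> fg; apply: evec_eq => w; rewrite !extendE; apply/ffunP => u.
by rewrite !ffunE; apply: eq_bigr => s _; rewrite fg.
Qed.

Variable v : K.

(* T_r, for s the place following r. *)
Definition heckeT (r s : 'I_d) : 'End(tensor) :=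
  extend (fun w : word =>
    let sw : word := [ffun t => w (tperm r s t)] in
    if w r == w s then v *: evec w
    else if (w r < w s)%N then evec sw
    else evec sw + (v - v^-1) *: evec w).

(* The endomorphisms of the H-module: as the T_r generate H, these are the
   linear maps commuting with every T_r (see qSchurP). *)
Definition qSchur : {vspace 'End(tensor)} :=
  (\bigcap_(p : 'I_d * 'I_d | p.2 == p.1.+1 :> nat)
     lker (linfun (commutator (heckeT p.1 p.2))))%VS.

Lemma qSchurP (f : 'End(tensor)) :
  reflect (forall r s : 'I_d, s = r.+1 :> nat ->
             (heckeT r s \o f = f \o heckeT r s)%VF)
          (f \in qSchur).
Proof.
apply: (iffP idP) => [fS r s rs | fT].
  have := @bigcapv_inf _ _ _ (r, s) (fun p : 'I_d * 'I_d => p.2 == p.1.+1 :> nat)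
    (fun p => lker (linfun (commutator (heckeT p.1 p.2)))) _ _ (subvv _).
  rewrite /= rs eqxx => /(_ isT) /subvP /(_ f fS).
  by rewrite memv_ker commutator_eq0 => /eqP.
rewrite memvE; apply/subv_bigcapP => p /eqP rs.
by rewrite -memvE memv_ker commutator_eq0 fT.
Qed.

(* The U-action on V, as matrices acting on columns. *)

Definition natE (i : nat) : 'M[K]_n :=
  \matrix_(a, b) ((a == i :> nat) && (b == i.+1 :> nat))%:R.

Definition natF (i : nat) : 'M[K]_n :=
  \matrix_(a, b) ((a == i.+1 :> nat) && (b == i :> nat))%:R.

Definition natK (i : nat) : 'M[K]_n :=
  diag_mx (\row_a (if a == i :> nat then v else 1)).

Definition natKV (i : nat) : 'M[K]_n :=
  diag_mx (\row_a (if a == i :> nat then v^-1 else 1)).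

(* The U-action on the tensor power: the (d-1)-fold iterates of
   Delta(E_i) = E_i (x) K_i K_(i+1)^-1 + 1 (x) E_i,
   Delta(F_i) = F_i (x) 1 + K_i^-1 K_(i+1) (x) F_i,
   Delta(K_i) = K_i (x) K_i. *)

Definition opE (i : nat) : 'End(tensor) :=
  \sum_(r < d) tensor_op (fun s : 'I_d =>
    if (s < r)%N then 1%:M
    else if s == r then natE i else natK i *m natKV i.+1).

Definition opF (i : nat) : 'End(tensor) :=
  \sum_(r < d) tensor_op (fun s : 'I_d =>
    if (s < r)%N then natKV i *m natK i.+1
    else if s == r then natF i else 1%:M).

Definition opK (i : nat) : 'End(tensor) := tensor_op (fun _ => natK i).

(* rootE_rec i l = X_(i, i+l+1) and rootF_rec i l = X_(i+l+1, i), by the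
   defining recursion with intermediate index k = i+1; the recursion then holds
   for every k, see rootE_split and rootF_split. *)

Fixpoint rootE_rec (i l : nat) : 'End(tensor) :=
  if l is l'.+1 then qbracket v (opE i) (rootE_rec i.+1 l') else opE i.

Fixpoint rootF_rec (i l : nat) : 'End(tensor) :=
  if l is l'.+1 then qbracket v^-1 (rootF_rec i.+1 l') (opF i) else opF i.

(* X_ij and X_ji respectively; meaningful for i < j only. *)
Definition rootE (i j : nat) := rootE_rec i (j - i).-1.
Definition rootF (i j : nat) := rootF_rec i (j - i).-1.

Lemma sum_tensor_op_comm (f g : 'I_d -> 'I_d -> 'M[K]_n) :
  (forall r t s, f r s *m g t s = g t s *m f r s) ->
  ((\sum_r tensor_op (f r)) \o (\sum_t tensor_op (g t)) =
   (\sum_t tensor_op (g t)) \o (\sum_r tensor_op (f r)))%VF.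
Proof.
move=> fg; have sumE (F G : 'I_d -> 'End(tensor)) :
    ((\sum_r F r) \o (\sum_t G t) = \sum_r \sum_t (F r \o G t))%VF.
  apply/lfunP => x; rewrite comp_lfunE !sum_lfunE; apply: eq_bigr => r _.
  rewrite sum_lfunE linear_sum; apply: eq_bigr => t _.
  by rewrite comp_lfunE.
rewrite !sumE exchange_big; apply: eq_bigr => t _; apply: eq_bigr => r _.
by rewrite !tensor_opM; apply: eq_tensor_op => s; apply: fg.
Qed.

Lemma diag_natE_comm (c : 'rV[K]_n) i :
  (forall a : 'I_n, (a == i :> nat) || (a == i.+1 :> nat) -> c 0 a = 1) ->
  natE i *m diag_mx c = diag_mx c *m natE i.
Proof.
move=> c1; apply/matrixP => a b; rewrite mul_mx_diag mul_diag_mx !mxE mulrC.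
case: eqP => [ai|_]; last by rewrite !mulr0.
case: eqP => [bi|_]; last by rewrite !mulr0.
by rewrite !c1 // ?ai ?bi eqxx ?orbT.
Qed.

Lemma natF_tr i : natF i = (natE i)^T.
Proof. by apply/matrixP => a b; rewrite !mxE andbC. Qed.

Lemma diag_natF_comm (c : 'rV[K]_n) i :
  (forall a : 'I_n, (a == i :> nat) || (a == i.+1 :> nat) -> c 0 a = 1) ->
  natF i *m diag_mx c = diag_mx c *m natF i.
Proof.
move=> c1; rewrite natF_tr -[diag_mx c]tr_diag_mx -!trmx_mul.
by rewrite diag_natE_comm.
Qed.

Lemma natE_comm i j : (i.+1 < j)%N -> natE i *m natE j = natE j *m natE i.
Proof.
move=> ij; have E0 k l (a b : 'I_n) : (k.+1 != l)%N -> 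
    (natE k *m natE l) a b = 0.
  move=> kl; rewrite mxE big1 // => c _; rewrite !mxE -natrM mulnb.
  case: (c =P l :> nat) => [cl|]; last by rewrite !andbF.
  by rewrite cl (eq_sym l) (negPf kl) andbF.
by apply/matrixP => a b; rewrite !E0 //; lia.
Qed.

Lemma natF_comm i j : (i.+1 < j)%N -> natF i *m natF j = natF j *m natF i.
Proof. by move=> ij; rewrite !natF_tr -!trmx_mul (natE_comm ij). Qed.

Lemma opE_comm i j : (i.+1 < j)%N -> (opE i \o opE j = opE j \o opE i)%VF.
Proof.
move=> ij; apply: sum_tensor_op_comm => r t s; rewrite !mulmx_diag.
case: (s < r)%N; first by rewrite mul1mx mulmx1.
case: (s < t)%N; first by rewrite mul1mx mulmx1.
case: (s == r); case: (s == t).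
- exact: natE_comm.
- by rewrite diag_natE_comm // => a ai; rewrite !mxE !ifN ?mulr1 //; lia.
- by rewrite diag_natE_comm // => a ai; rewrite !mxE !ifN ?mulr1 //; lia.
by rewrite !mulmx_diag; congr diag_mx; apply/rowP => a; rewrite !mxE mulrC.
Qed.

Lemma opF_comm i j : (i.+1 < j)%N -> (opF i \o opF j = opF j \o opF i)%VF.
Proof.
move=> ij; apply: sum_tensor_op_comm => r t s; rewrite !mulmx_diag.
case: (s < r)%N; case: (s < t)%N.
- by rewrite !mulmx_diag; congr diag_mx; apply/rowP => a; rewrite !mxE mulrC.
- case: (s == t); last by rewrite mul1mx mulmx1.
  by rewrite diag_natF_comm // => a ai; rewrite !mxE !ifN ?mulr1 //; lia.
- case: (s == r); last by rewrite mul1mx mulmx1.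
  by rewrite diag_natF_comm // => a ai; rewrite !mxE !ifN ?mulr1 //; lia.
case: (s == r); last by rewrite mul1mx mulmx1.
case: (s == t); last by rewrite mul1mx mulmx1.
exact: natF_comm.
Qed.

Lemma rootE_rec_comm i k l : (i.+1 < k)%N ->
  (opE i \o rootE_rec k l = rootE_rec k l \o opE i)%VF.
Proof.
elim: l k => [|l IHl] k ik /=; first exact: opE_comm.
by apply: qbracket_comm; [apply: opE_comm | apply: IHl; apply: leqW].
Qed.

Lemma rootF_rec_comm i k l : (i.+1 < k)%N ->
  (opF i \o rootF_rec k l = rootF_rec k l \o opF i)%VF.
Proof.
elim: l k => [|l IHl] k ik /=; first exact: opF_comm.
by apply: qbracket_comm; [apply: IHl; apply: leqW | apply: opF_comm].
Qed.

Lemma rootE_split i k j : (i < k < j)%N ->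
  rootE i j = qbracket v (rootE i k) (rootE k j).
Proof.
have splitE l m h : rootE_rec h (l + m).+1 =
    qbracket v (rootE_rec h l) (rootE_rec (h + l).+1 m).
  elim: l h => [|l IHl] h; first by rewrite addn0.
  rewrite addSn -[LHS]/(qbracket v (opE h) (rootE_rec h.+1 (l + m).+1)) IHl.
  by rewrite qbracketA addSnnS //; apply: rootE_rec_comm; lia.
move=> /andP[ik kj]; rewrite /rootE.
have -> : (j - i).-1 = ((k - i).-1 + (j - k).-1).+1 by lia.
by rewrite splitE; congr (qbracket _ _ (rootE_rec _ _)); lia.
Qed.

Lemma rootF_split i k j : (i < k < j)%N ->
  rootF i j = qbracket v^-1 (rootF k j) (rootF i k).
Proof.
have splitF l m h : rootF_rec h (l + m).+1 =
    qbracket v^-1 (rootF_rec (h + l).+1 m) (rootF_rec h l).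
  elim: l h => [|l IHl] h; first by rewrite addn0.
  rewrite addSn -[LHS]/(qbracket v^-1 (rootF_rec h.+1 (l + m).+1) (opF h)) IHl.
  by rewrite -qbracketA addSnnS //; apply/esym/rootF_rec_comm; lia.
move=> /andP[ik kj]; rewrite /rootF.
have -> : (j - i).-1 = ((k - i).-1 + (j - k).-1).+1 by lia.
by rewrite splitF; congr (qbracket _ (rootF_rec _ _) _); lia.
Qed.

(* The index set of G': the pair (i, j) stands for E_alpha = X_ij if i < j, for
   F_alpha = X_ij if i > j, and for K_i if i = j. *)
Definition gidx (k0 : 'I_n) := {p : 'I_n * 'I_n | p != (k0, k0)}.

Definition gen (k0 : 'I_n) (g : gidx k0) : 'End(tensor) :=
  let: (i, j) := val g in
  if (i < j)%N then rootE i j else if (j < i)%N then rootF j i else opK i.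

Definition monomial (k0 : 'I_n) (le : rel (gidx k0)) (m : gidx k0 -> nat) :
    'End(tensor) :=
  \big[(@comp_lfun K tensor tensor tensor) / \1%VF]_(g <- sort le (enum {: gidx k0}))
    iter (m g) (comp_lfun (gen g)) \1%VF.

(* Exponents are bounded by d only to make the index type finite. *)
Definition monomials_le (k0 : 'I_n) (le : rel (gidx k0)) : seq 'End(tensor) :=
  [seq monomial le (fun g => m g : nat) | m : {ffun gidx k0 -> 'I_d.+1}
     in [pred m : {ffun gidx k0 -> 'I_d.+1} | (\sum_g m g <= d)%N]].

End TensorSpace.

Definition Qv : fieldType := {fraction {poly rat}}.
Definition indet : Qv := tofrac ('X : {poly rat}).

(* Main.v *)
From HB Require Import structures.
Require Import Defs.
From mathcomp Require Import all_boot all_order all_algebra all_fingroup.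
From mathcomp Require Import generic_quotient zify ring.

(** Everything is specialised at v = 1, for rational functions regular there.
    In the monomials replace each K_k by (K_k - 1)/(v - 1); the new monomials
    lie in the span of the old ones, slot by slot, and specialise to ordered
    products of the operators sum_s 1 (x) ... (x) e (x) ... (x) 1 with e a matrix
    unit other than e_(k0,k0).  These units together with 1 form a basis of M_n,
    and a product of l <= d of them has as leading term the symmetrisation of
    their tensor product, so distinct multisets give linearly independent
    operators.  As a relation over Q(v) can be rescaled to a nonzero relation at
    v = 1, the monomials span a space of dimension at least their number.
    Conversely, an element of S(n,d) rescales to a nonzero operator at v = 1
    commuting with the symmetric group, whose coefficients are constant on orbits
    of pairs of words; such an orbit is determined by the multiplicities of the
    pairs other than (k0,k0), so dim S(n,d) is at most the number of monomials. *)

Set Implicit Arguments.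
Unset Strict Implicit.
Unset Printing Implicit Defensive.

Import Order.TTheory GRing.Theory Num.Theory.
Local Open Scope ring_scope.

(** * Specialisation at v = 1 *)

Section Specialization.
Implicit Types (p q : {poly rat}) (x y : Qv) (a b : rat).

(** [x] is regular at v = 1 with value [a]. Evaluation is only partial, hence a relation;
    [spec_unique] shows that the value is determined. *)
Definition spec x a :=
  exists p q, [/\ q.[1] != 0, x = tofrac p / tofrac q & a = p.[1] / q.[1]].

Lemma tofrac_neq0 q : q.[1] != 0 -> tofrac q != 0.
Proof. by move=> q1; rewrite tofrac_eq0; apply: contraNneq q1 => ->; rewrite horner0. Qed.

Lemma spec_poly p : spec (tofrac p) p.[1].
Proof. by exists p, 1; rewrite hornerC oner_eq0 tofrac1 !divr1. Qed.

Lemma specD x y a b : spec x a -> spec y b -> spec (x + y) (a + b).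
Proof.
move=> [p [q [q1 -> ->]]] [p' [q' [q1' -> ->]]].
exists (p * q' + p' * q), (q * q'); rewrite hornerD !hornerM mulf_neq0 //; split=> //.
  by rewrite tofracD !tofracM addf_div ?tofrac_neq0.
by rewrite addf_div.
Qed.

Lemma specM x y a b : spec x a -> spec y b -> spec (x * y) (a * b).
Proof.
move=> [p [q [q1 -> ->]]] [p' [q' [q1' -> ->]]].
exists (p * p'), (q * q'); rewrite !hornerM mulf_neq0 //; split=> //.
  by rewrite !tofracM mulf_div.
by rewrite mulf_div.
Qed.

Lemma specV x a : a != 0 -> spec x a -> spec x^-1 a^-1.
Proof.
move=> a0 [p [q [q1 -> aE]]]; exists q, p; rewrite !invf_div aE invf_div; split=> //.
by apply: contraNneq a0 => p0; rewrite aE p0 mul0r.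
Qed.

Lemma spec_nat k : spec k%:R k%:R.
Proof. by have := spec_poly k%:R; rewrite rmorph_nat -polyC_natr hornerC. Qed.

Lemma specN x a : spec x a -> spec (- x) (- a).
Proof.
move=> xa; have := specM (spec_poly (- 1)) xa.
by rewrite tofracN tofrac1 hornerN hornerC !mulN1r.
Qed.

Lemma spec_indet : spec indet 1.
Proof. by have := spec_poly 'X; rewrite hornerX. Qed.

Lemma spec_indetV : spec indet^-1 1.
Proof. by have := specV (oner_neq0 _) spec_indet; rewrite invr1. Qed.

Lemma spec_sum (I : Type) (r : seq I) (P : pred I) (F : I -> Qv) (G : I -> rat) :
  (forall i, P i -> spec (F i) (G i)) ->
  spec (\sum_(i <- r | P i) F i) (\sum_(i <- r | P i) G i).
Proof.
by move=> FG; elim/big_rec2: _ => [|i x a Pi xa]; [exact: (spec_nat 0) | apply: specD; auto].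
Qed.

Lemma spec_prod (I : Type) (r : seq I) (P : pred I) (F : I -> Qv) (G : I -> rat) :
  (forall i, P i -> spec (F i) (G i)) ->
  spec (\prod_(i <- r | P i) F i) (\prod_(i <- r | P i) G i).
Proof.
by move=> FG; elim/big_rec2: _ => [|i x a Pi xa]; [exact: (spec_nat 1) | apply: specM; auto].
Qed.

Lemma spec0_unique a : spec 0 a -> a = 0.
Proof.
move=> [p [q [q1 /esym/eqP]]]; rewrite mulf_eq0 invr_eq0 (negPf (tofrac_neq0 q1)) orbF.
by rewrite tofrac_eq0 => /eqP -> ->; rewrite horner0 mul0r.
Qed.

Lemma spec_unique x a b : spec x a -> spec x b -> a = b.
Proof.
move=> xa /specN /(specD xa); rewrite subrr => /spec0_unique /eqP.
by rewrite subr_eq0 => /eqP.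
Qed.

(** In lowest terms, a common zero of numerator and denominator at 1 cannot hide regularity
    there. *)
Lemma fraction_coprime x :
  exists p q, [/\ coprimep p q, q != 0 & x = tofrac p / tofrac q].
Proof.
have [p [q [q0 ->]]] : exists p q, q != 0 /\ x = tofrac p / tofrac q.
  elim/generic_quotient.quotW: x => r; exists (frac r).1, (frac r).2.
  have d0 := denom_ratioP r; split=> //.
  apply: (canRL (mulfK _)); first by rewrite tofrac_eq0.
  rewrite /GRing.mul /= !piE; apply/eqmodP; rewrite /= FracField.equivfE.
  by rewrite /FracField.mulf !numden_Ratio ?mulr1 ?oner_eq0 ?mulf_neq0 // mulrC.
have g0 : gcdp p q != 0 by rewrite gcdp_eq0 (negPf q0) andbF.
exists (p %/ gcdp p q), (q %/ gcdp p q); split.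
- by rewrite coprimep_div_gcd // q0 orbT.
- by apply: contraNneq q0 => q'0; rewrite -(divpK (dvdp_gcdr p q)) q'0 mul0r.
rewrite -[in LHS](divpK (dvdp_gcdl p q)) -[in X in _ / X](divpK (dvdp_gcdr p q)).
by rewrite !tofracM -mulf_div divff ?mulr1 // tofrac_eq0.
Qed.

(** The functions regular at 1 form a valuation ring: numerator and denominator in lowest terms do
    not both vanish at 1. *)
Lemma spec_total x : (exists a, spec x a) \/ exists a, spec x^-1 a.
Proof.
have [p [q [pq q0 ->]]] := fraction_coprime x.
have [q1|q1] := eqVneq q.[1] 0; last by left; exists (p.[1] / q.[1]), p, q.
right; exists (q.[1] / p.[1]), q, p; rewrite invf_div; split=> //.
by rewrite coprimep_sym in pq; apply: (coprimep_root pq); apply/rootP.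
Qed.

(** Dividing by an entry of least valuation at v = 1 makes every entry regular and turns that entry
    into 1. *)
Lemma spec_scale (I : finType) (x : I -> Qv) : (exists i, x i != 0) ->
  exists c (a : I -> rat), (forall i, spec (c * x i) (a i)) /\ exists i, a i != 0.
Proof.
move=> [i0 xi0].
have [j xj0 jmax] : exists2 j, x j != 0 & forall i, i \in enum I -> exists a, spec ((x j)^-1 * x i) a.
  elim: (enum I) => [|i s [j xj0 IH]]; first by exists i0.
  have [xi|xi] := eqVneq (x i) 0.
    exists j => // k; rewrite inE => /orP[/eqP ->|/IH //].
    by exists 0; rewrite xi mulr0; apply: (spec_nat 0).
  have [[a Ha]|[a Ha]] := spec_total ((x j)^-1 * x i).
    by exists j => // k; rewrite inE => /orP[/eqP ->|/IH //]; exists a.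
  (* Now x j / x i is regular, so [i] becomes the pivot; an earlier x k / x i is the product of x j
     / x i and x k / x j. *)
  exists i => // k; rewrite inE => /orP[/eqP ->|/IH [b Hb]].
    by exists 1; rewrite mulVf //; apply: (spec_nat 1).
  exists (a * b); have := specM Ha Hb; congr spec.
  by rewrite invfM invrK mulrACA mulfV // mul1r.
have /fin_all_exists [a Ha] i : exists a, spec ((x j)^-1 * x i) a.
  by apply: jmax; rewrite mem_enum.
exists (x j)^-1, a; split=> //; exists j.
have := Ha j; rewrite mulVf // => /(spec_unique (spec_nat 1)) <-.
exact: oner_neq0.
Qed.

End Specialization.

(** * Coefficients and the Hecke action *)

Section Coefficients.
Variables (K : fieldType) (n d : nat).
Local Notation word := (word n d).
Local Notation End := 'End(tensor K n d).
Implicit Types (f g : End) (u w : word).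

Definition coef f u w : K := f (evec K w) u.

Lemma coefE f (x : tensor K n d) u : f x u = \sum_w coef f u w * x w.
Proof.
have {1}-> : x = \sum_w (x w : K) *: evec K w.
  apply/ffunP => t; rewrite sum_ffunE (bigD1 t) //= !ffunE eqxx.
  rewrite /GRing.scale /= mulr1 big1 ?addr0 // => w wu.
  by rewrite !ffunE eq_sym (negPf wu) /GRing.scale /= mulr0.
rewrite linear_sum sum_ffunE; apply: eq_bigr => w _.
by rewrite linearZ ffunE /coef mulrC.
Qed.

Lemma coef_comp f g u w : coef (f \o g)%VF u w = \sum_t coef f u t * coef g t w.
Proof. by rewrite {1}/coef comp_lfunE coefE. Qed.

Lemma coef_inj f g : (forall u w, coef f u w = coef g u w) -> f = g.
Proof. by move=> fg; apply: evec_eq => w; apply/ffunP => u; apply: fg. Qed.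

Lemma coefD f g u w : coef (f + g) u w = coef f u w + coef g u w.
Proof. by rewrite /coef add_lfunE ffunE. Qed.

Lemma coefZ a f u w : coef (a *: f) u w = a * coef f u w.
Proof. by rewrite /coef scale_lfunE ffunE. Qed.

Lemma coefB f g u w : coef (f - g) u w = coef f u w - coef g u w.
Proof. by rewrite coefD -scaleN1r coefZ mulN1r. Qed.

Lemma coef_sum (I : Type) (r : seq I) (P : pred I) (F : I -> End) u w :
  coef (\sum_(i <- r | P i) F i) u w = \sum_(i <- r | P i) coef (F i) u w.
Proof. by rewrite /coef sum_lfunE sum_ffunE. Qed.

Lemma coef_id u w : coef \1%VF u w = (u == w)%:R.
Proof. by rewrite /coef id_lfunE ffunE. Qed.

Lemma coef_tensor_op (f : 'I_d -> 'M[K]_n) u w :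
  coef (tensor_op f) u w = \prod_s f s (u s) (w s).
Proof. by rewrite /coef extendE ffunE. Qed.

Definition swap (r s : 'I_d) w : word := [ffun t => w (tperm r s t)].

Lemma swapK r s : involutive (swap r s).
Proof. by move=> w; apply/ffunP => t; rewrite !ffunE tpermK. Qed.

Lemma swap_id r s w : w r = w s -> swap r s w = w.
Proof. by move=> rs; apply/ffunP => t; rewrite ffunE; case: tpermP => [->|->|]. Qed.

Variable v : K.

(** The matrix of T_r on words is symmetric, so one formula serves for both products with T_r: [a],
    [b] are the letters at the two places, [x] is the coefficient at the word and [y] the one at the
    swapped word. *)
Definition hecke_formula (a b : 'I_n) (x y : K) : K :=
  if a == b then v * x else y + (b < a)%:R * (v - v^-1) * x.

Lemma coef_comp_heckeT f r s u w :
  coef (f \o heckeT n v r s)%VF u w =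
  hecke_formula (w r) (w s) (coef f u w) (coef f u (swap r s w)).
Proof.
rewrite /coef /hecke_formula comp_lfunE extendE -/(swap r s w).
case: eqP => [_|rs]; first by rewrite linearZ ffunE.
case: ltngtP => [| |/val_inj //] _; first by rewrite !mul0r addr0.
by rewrite linearD linearZ !ffunE mul1r.
Qed.

Lemma coef_heckeT r s u w :
  coef (heckeT n v r s) u w =
  hecke_formula (u r) (u s) (u == w)%:R (swap r s u == w)%:R.
Proof.
rewrite -[heckeT _ _ _ _]comp_lfun1l coef_comp_heckeT !coef_id.
have [<-|uw] := eqVneq u w.
  by congr hecke_formula; rewrite eq_sym.
rewrite -(inv_eq (@swapK r s)) /hecke_formula !mulr0 !addr0.
have [<-|sw] := eqVneq (swap r s u) w; last by rewrite !if_same.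
by rewrite !ffunE tpermL tpermR eq_sym.
Qed.

Lemma coef_heckeT_comp f r s u w :
  coef (heckeT n v r s \o f)%VF u w =
  hecke_formula (u r) (u s) (coef f u w) (coef f (swap r s u) w).
Proof.
rewrite coef_comp (eq_bigr (fun t => hecke_formula (u r) (u s)
  ((u == t)%:R * coef f t w) ((swap r s u == t)%:R * coef f t w))); last first.
  by move=> t _; rewrite coef_heckeT /hecke_formula; case: ifP => _; ring.
have pick (t0 : word) : \sum_t (t0 == t)%:R * coef f t w = coef f t0 w.
  rewrite (bigD1 t0) //= eqxx mul1r big1 ?addr0 // => t.
  by rewrite eq_sym => /negPf ->; rewrite mul0r.
rewrite /hecke_formula; case: ifP => _; first by rewrite -mulr_sumr pick.
by rewrite big_split -mulr_sumr !pick.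
Qed.

(** T_r only involves the places [r] and [s]. Once the contribution [R] of the other places factors
    out, commutation is an identity on the tensor square of V. *)
Lemma two_site_commute f r s (R : word -> word -> K)
    (B : 'I_n -> 'I_n -> 'I_n -> 'I_n -> K) :
  (forall u w, coef f u w = R u w * B (u r) (u s) (w r) (w s)) ->
  (forall u w, R (swap r s u) w = R u w) ->
  (forall u w, R u (swap r s w) = R u w) ->
  (forall a b c e, hecke_formula a b (B a b c e) (B b a c e) =
                   hecke_formula c e (B a b c e) (B a b e c)) ->
  (heckeT n v r s \o f = f \o heckeT n v r s)%VF.
Proof.
move=> fE Rl Rr Bsym; apply: coef_inj => u w.
rewrite coef_heckeT_comp coef_comp_heckeT !fE Rl Rr !ffunE !tpermL !tpermR.
have RM a b x y : hecke_formula a b (R u w * x) (R u w * y) =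
    R u w * hecke_formula a b x y.
  by rewrite /hecke_formula; case: ifP => _; ring.
by rewrite !RM Bsym.
Qed.

Lemma tensor_op_rest (f : 'I_d -> 'M[K]_n) (r s : 'I_d) u w : r != s ->
  coef (tensor_op f) u w =
  (\prod_(t | (t != r) && (t != s)) f t (u t) (w t)) *
  (f r (u r) (w r) * f s (u s) (w s)).
Proof.
move=> rs; rewrite coef_tensor_op (bigD1 r) //= (bigD1 s) 1?eq_sym //=.
by rewrite mulrA mulrC.
Qed.

Lemma rest_swapl (f : 'I_d -> 'M[K]_n) (r s : 'I_d) u w :
  \prod_(t | (t != r) && (t != s)) f t (swap r s u t) (w t) =
  \prod_(t | (t != r) && (t != s)) f t (u t) (w t).
Proof.
apply: eq_bigr => t /andP[tr ts].
by rewrite ffunE tpermD // eq_sym.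
Qed.

Lemma rest_swapr (f : 'I_d -> 'M[K]_n) (r s : 'I_d) u w :
  \prod_(t | (t != r) && (t != s)) f t (u t) (swap r s w t) =
  \prod_(t | (t != r) && (t != s)) f t (u t) (w t).
Proof.
apply: eq_bigr => t /andP[tr ts].
by rewrite ffunE tpermD // eq_sym.
Qed.

Lemma commute_sum (T : End) (I : Type) (r : seq I) (P : pred I) (F : I -> End) :
  (forall i, P i -> (T \o F i = F i \o T)%VF) ->
  (T \o (\sum_(i <- r | P i) F i) = (\sum_(i <- r | P i) F i) \o T)%VF.
Proof.
move=> TF; elim/big_rec: _ => [|i f Pi IH]; first by rewrite comp_lfun0l comp_lfun0r.
by rewrite comp_lfunDl comp_lfunDr TF // IH.
Qed.

Lemma diag_commute r s (f : 'I_d -> 'M[K]_n) (c : 'rV[K]_n) : r != s ->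
  f r = diag_mx c -> f s = diag_mx c ->
  (heckeT n v r s \o tensor_op f = tensor_op f \o heckeT n v r s)%VF.
Proof.
move=> rs fr fs; apply: (two_site_commute
  (R := fun u w => \prod_(t | (t != r) && (t != s)) f t (u t) (w t))
  (B := fun a b a' b' => f r a a' * f s b b')).
- by move=> u w; apply: tensor_op_rest.
- by move=> u w; apply: rest_swapl.
- by move=> u w; apply: rest_swapr.
move=> a b a' b'; rewrite fr fs !mxE /hecke_formula.
(* [e] gives the entries of the common diagonal matrix; two entries in one row and different columns
   cannot both be nonzero. *)
pose e x x' := c 0 x *+ (x == x').
have e0 x y z : y != z -> e x y * e x z = 0.
  by rewrite /e => yz; case: (x =P y) => [->|]; rewrite ?(negPf yz) ?mulr0n ?mulr0 ?mul0r.
rewrite -/(e a a') -/(e b b') -/(e b a') -/(e a b').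
have [ab|ab] := eqVneq a b; have [ab'|ab'] := eqVneq a' b'.
- by [].
- by rewrite -ab e0 // e0 1?eq_sym // !mulr0 addr0.
- by rewrite -ab' /e; case: (a =P a') => [<-|]; rewrite 1?eq_sym ?(negPf ab) ?mulr0n ?mulr0 ?mul0r ?mulr0 ?addr0.
rewrite [e b a' * _]mulrC; congr (_ + _); rewrite /e.
by case: (a =P a') => [->|]; case: (b =P b') => [->|]; rewrite ?mulr0n ?mulr0 ?mul0r ?mulr0.
Qed.

(* E and F act through this pattern, with D = 1, resp. D' = 1. *)
Lemma skew_derivation_commute (r s : 'I_d) (D D' : 'rV[K]_n) (X : 'M[K]_n) :
  s = r.+1 :> nat ->
  (forall a b a' b', let B := fun a b a' b' =>
       X a a' * diag_mx D' b b' + diag_mx D a a' * X b b' in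
     hecke_formula a b (B a b a' b') (B b a a' b') =
     hecke_formula a' b' (B a b a' b') (B a b b' a')) ->
  let f := \sum_(p < d) tensor_op (fun t : 'I_d =>
    if (t < p)%N then diag_mx D else if t == p then X else diag_mx D') in
  (heckeT n v r s \o f = f \o heckeT n v r s)%VF.
Proof.
move=> sr Bsym f; rewrite {}/f.
have rs : r != s by rewrite -val_eqE /= sr; lia.
(* The terms for [r] and [s] commute with T_r only as a sum, which is the hypothesis on two places;
   every other term commutes by itself. *)
rewrite (bigD1 r) //= (bigD1 s) 1?eq_sym //= addrA comp_lfunDl comp_lfunDr.
congr (_ + _).
  apply: (two_site_commute
    (R := fun u w => \prod_(t | (t != r) && (t != s))
       (if (t < r)%N then diag_mx D else diag_mx D') (u t) (w t))
    (B := fun a b a' b' =>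
       X a a' * diag_mx D' b b' + diag_mx D a a' * X b b')) => //.
  - move=> u w; rewrite coefD !(@tensor_op_rest _ r s) //= !ltnn !eqxx.
    rewrite sr ltnS leqnn ltnNge leqnSn /= eq_sym (negPf rs) mulrDr.
    congr (_ * _ + _ * _); apply: eq_bigr => t /andP[tr ts].
      by rewrite (negPf tr).
    rewrite (negPf ts) ltnS leq_eqVlt; case: eqP => // /val_inj e.
    by rewrite e eqxx in tr.
  - by move=> u w; apply: (rest_swapl (fun t => if (t < r)%N then diag_mx D else diag_mx D')).
  - by move=> u w; apply: (rest_swapr (fun t => if (t < r)%N then diag_mx D else diag_mx D')).
(* As [r] and [s] are adjacent, they lie on the same side of [p] and carry the same diagonal
   matrix. *)
apply: commute_sum => p /andP[pr ps].
apply: (@diag_commute _ _ _ (if (r < p)%N then D else D')) => //.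
  by rewrite eq_sym (negPf pr); case: ifP.
rewrite eq_sym (negPf ps) sr.
have -> : (r.+1 < p)%N = (r < p)%N by move: ps; rewrite -val_eqE /= sr; lia.
by case: ifP.
Qed.

Hypothesis v0 : v != 0.


End Coefficients.

(** * Generators lie in S(n,d) *)

Section Sites.
Variables (K : fieldType) (v : K).
Hypothesis v0 : v != 0.

Ltac prune := rewrite /= ?andbF ?mulr1n ?mulr0n ?mul0r ?mulr0 ?mul0r ?addr0 ?add0r ?addr0 ?mulr0 ?if_same ?eqxx /=.
(** Splits on the equalities, then on the inequalities between indices; each surviving case is a
    rational identity in [v]. *)
Ltac eqn_cases := prune; try done; repeat (match goal with
  | |- context [eq_op ?x ?y] => case: (@eqP _ x y) => ?; subst; try lia
  end; prune; try done); repeat (match goal with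
  | |- context [leq (S ?x) ?y] => case: (ltnP x y) => ?; try lia
  end; prune; try done); try (by rewrite ?mul1r ?mulr1 ?mul1r); field; exact: v0.

(** The check on the tensor square for E_i, with [D'] the diagonal of K_i K_(i+1)^-1. Indices are
    naturals so that [lia] discards impossible cases. *)
Lemma siteE (i a b a' b' : nat) :
  let X a a' : K := ((a == i) && (a' == i.+1))%:R in
  let D' b b' : K := ((if b == i then v else 1) * (if b == i.+1 then v^-1 else 1)) *+ (b == b') in
  let D a a' : K := 1 *+ (a == a') in
  let B a b a' b' := X a a' * D' b b' + D a a' * X b b' in
  (if a == b then v * B a b a' b'
   else B b a a' b' + (b < a)%:R * (v - v^-1) * B a b a' b') =
  (if a' == b' then v * B a b a' b'
   else B a b b' a' + (b' < a')%:R * (v - v^-1) * B a b a' b').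
Proof.
rewrite /=.
eqn_cases.
Qed.

Lemma siteF (i a b a' b' : nat) :
  let X a a' : K := ((a == i.+1) && (a' == i))%:R in
  let D b b' : K := ((if b == i then v^-1 else 1) * (if b == i.+1 then v else 1)) *+ (b == b') in
  let D' a a' : K := 1 *+ (a == a') in
  let B a b a' b' := X a a' * D' b b' + D a a' * X b b' in
  (if a == b then v * B a b a' b'
   else B b a a' b' + (b < a)%:R * (v - v^-1) * B a b a' b') =
  (if a' == b' then v * B a b a' b'
   else B a b b' a' + (b' < a')%:R * (v - v^-1) * B a b a' b').
Proof.
rewrite /=.
eqn_cases.
Qed.

Variables (n d : nat).
Implicit Types (f g : 'End(tensor K n d)).

Lemma hecke_formula_natE (a b : 'I_n) (x y : K) : hecke_formula v a b x y =
  if a == b :> nat then v * x else y + (b < a)%:R * (v - v^-1) * x.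
Proof. by rewrite /hecke_formula val_eqE. Qed.

Lemma opE_commute (r s : 'I_d) i : s = r.+1 :> nat ->
  (heckeT n v r s \o opE n d v i = opE n d v i \o heckeT n v r s)%VF.
Proof.
move=> rs; rewrite /opE mulmx_diag -diag_const_mx.
apply: skew_derivation_commute => // a b a' b' B.
rewrite !hecke_formula_natE /B !mxE; exact: siteE.
Qed.

Lemma opF_commute (r s : 'I_d) i : s = r.+1 :> nat ->
  (heckeT n v r s \o opF n d v i = opF n d v i \o heckeT n v r s)%VF.
Proof.
move=> rs; rewrite /opF mulmx_diag -diag_const_mx.
apply: skew_derivation_commute => // a b a' b' B.
rewrite !hecke_formula_natE /B !mxE; exact: siteF.
Qed.

Lemma opK_commute (r s : 'I_d) i : s = r.+1 :> nat ->
  (heckeT n v r s \o opK n d v i = opK n d v i \o heckeT n v r s)%VF.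
Proof.
move=> rs; apply: (@diag_commute _ _ _ v _ _ _ (\row_a (if a == i :> nat then v else 1))) => //.
by rewrite -val_eqE /= rs; lia.
Qed.

Lemma opE_qSchur i : opE n d v i \in qSchur n d v.
Proof. by apply/qSchurP => r s; apply: opE_commute. Qed.

Lemma opF_qSchur i : opF n d v i \in qSchur n d v.
Proof. by apply/qSchurP => r s; apply: opF_commute. Qed.

Lemma opK_qSchur i : opK n d v i \in qSchur n d v.
Proof. by apply/qSchurP => r s; apply: opK_commute. Qed.

Lemma comp_qSchur f g :
  f \in qSchur n d v -> g \in qSchur n d v -> (f \o g)%VF \in qSchur n d v.
Proof.
move=> /qSchurP fS /qSchurP gS; apply/qSchurP => r s rs.
by rewrite comp_lfunA fS // -comp_lfunA gS // comp_lfunA.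
Qed.

Lemma id_qSchur : (\1%VF : 'End(tensor K n d)) \in qSchur n d v.
Proof. by apply/qSchurP => r s rs; rewrite comp_lfun1l comp_lfun1r. Qed.

Lemma qbracket_qSchur q f g :
  f \in qSchur n d v -> g \in qSchur n d v -> qbracket q f g \in qSchur n d v.
Proof. by move=> fS gS; rewrite memvB ?memvZ ?comp_qSchur. Qed.

Lemma rootE_rec_qSchur i l : rootE_rec n d v i l \in qSchur n d v.
Proof.
by elim: l i => [|l IH] i /=; rewrite ?qbracket_qSchur ?opE_qSchur ?IH.
Qed.

Lemma rootF_rec_qSchur i l : rootF_rec n d v i l \in qSchur n d v.
Proof.
by elim: l i => [|l IH] i /=; rewrite ?qbracket_qSchur ?opF_qSchur ?IH.
Qed.

Lemma gen_qSchur k0 (g : gidx k0) : gen d v g \in qSchur n d v.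
Proof.
rewrite /gen; case: (val g) => i j; case: ifP => _; first exact: rootE_rec_qSchur.
by case: ifP => _; [exact: rootF_rec_qSchur | exact: opK_qSchur].
Qed.

Lemma monomial_qSchur k0 (le : rel (gidx k0)) m :
  monomial d v le m \in qSchur n d v.
Proof.
apply: (big_ind (fun f => f \in qSchur n d v)) => [|f g|g _]; [exact: id_qSchur | exact: comp_qSchur |].
by elim: (m g) => [|a IH] /=; rewrite ?id_qSchur ?comp_qSchur ?gen_qSchur.
Qed.

End Sites.

(** * Independence of products of place sums *)

Section PlaceSums.
Variables (K : numFieldType) (n d : nat).
Local Notation End := 'End(tensor K n d).
Implicit Types (A : 'I_d -> 'M[K]_n) (X : 'M[K]_n) (f : End).

Definition place (s : 'I_d) X : End :=
  tensor_op (fun t => if t == s then X else 1%:M).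

(** The derivation action of X in gl_n on the tensor power, which is what the coproduct becomes at v
    = 1. *)
Definition place_sum X : End := \sum_s place s X.

(** The trace of [f] against a pure tensor operator; such forms will isolate single coefficients of
    a linear relation. *)
Definition trace_form A f : K := \sum_w coef (tensor_op A \o f)%VF w w.

Definition mulr_at A s X : 'I_d -> 'M[K]_n :=
  fun t => if t == s then A s *m X else A t.

Lemma trace_formZ A a f : trace_form A (a *: f) = a * trace_form A f.
Proof.
rewrite mulr_sumr; apply: eq_bigr => w _.
by rewrite -comp_lfunZr coefZ.
Qed.

Lemma trace_form_sum A (I : Type) (r : seq I) (P : pred I) (F : I -> End) :
  trace_form A (\sum_(i <- r | P i) F i) = \sum_(i <- r | P i) trace_form A (F i).
Proof.
rewrite /trace_form exchange_big; apply: eq_bigr => w _.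
rewrite -coef_sum; congr (coef _ _ _); elim/big_rec2: _ => [|i f g _ <-].
  by rewrite comp_lfun0r.
by rewrite comp_lfunDr.
Qed.

Lemma trace_form_place_sum A X f :
  trace_form A (place_sum X \o f)%VF = \sum_s trace_form (mulr_at A s X) f.
Proof.
have -> : (place_sum X \o f)%VF = \sum_s (place s X \o f)%VF.
  rewrite /place_sum; elim/big_rec2: _ => [|i g h _ <-].
    by rewrite comp_lfun0l.
  by rewrite comp_lfunDl.
rewrite trace_form_sum; apply: eq_bigr => s _; apply: eq_bigr => w _.
rewrite comp_lfunA tensor_opM; congr (coef (_ \o f)%VF _ _).
apply: eq_tensor_op => t; rewrite /mulr_at; case: eqP => [->//|_].
by rewrite mulmx1.
Qed.

Lemma trace_form_id A : trace_form A \1%VF = \prod_s \tr (A s).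
Proof.
rewrite bigA_distr_bigA; apply: eq_bigr => w _.
by rewrite comp_lfun1r coef_tensor_op.
Qed.

Definition traceless A := [pred s | \tr (A s) == 0].

(** Only the factor at [s] changes, so at most one traceless factor is lost. *)
Lemma traceless_mulr_at A s X :
  (#|traceless A| <= #|traceless (mulr_at A s X)|.+1)%N.
Proof.
apply: (@leq_trans #|predU1 s (mem (traceless (mulr_at A s X)))|); last first.
  by rewrite cardU1 -add1n leq_add2r leq_b1.
apply/subset_leq_card/subsetP => t; rewrite !inE /mulr_at.
by case: (t =P s).
Qed.

Variables (G : finType) (X : G -> 'M[K]_n).

Definition place_prod (gs : seq G) : End :=
  foldr (fun g f => place_sum (X g) \o f)%VF \1%VF gs.

(* A product of l place sums moves at most l tensor places, hence is invisible
   to a form with more than l traceless factors. *)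
Lemma trace_form_prod_eq0 A gs :
  (size gs < #|traceless A|)%N -> trace_form A (place_prod gs) = 0.
Proof.
elim: gs A => [|g gs IH] A /= lt_gs.
  rewrite trace_form_id; have /card_gt0P[s sA] := lt_gs.
  by rewrite (bigD1 s) //= (eqP sA) mul0r.
rewrite trace_form_place_sum big1 // => s _; apply: IH.
by rewrite -ltnS (leq_trans lt_gs) ?traceless_mulr_at.
Qed.

Variable Z : G -> 'M[K]_n.
Hypothesis tr_dual : forall g h, \tr (Z g *m X h) = (g == h)%:R.
Hypothesis tr_Z : forall g, \tr (Z g) = 0.

(** [b] labels the places by elements of [G]; [None] marks a place that will carry a factor of trace
    one. *)
Definition content (b : 'I_d -> option G) g := #|[pred s | b s == Some g]|.

(** With as many labelled places as factors, the form counts the bijections between the two that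
    respect labels. The induction tracks only whether this number is positive or zero. *)
Lemma trace_form_prod A (b : 'I_d -> option G) gs :
  (forall s g, b s = Some g -> A s = Z g) ->
  (forall s, b s = None -> \tr (A s) = 1) ->
  size gs = #|[pred s | b s != None]| ->
  if [forall g, content b g == count_mem g gs] then is_true (0 < trace_form A (place_prod gs))
  else trace_form A (place_prod gs) = 0.
Proof.
elim: gs A b => [|g gs IH] A b AS AN sz.
  have b0 s : b s = None.
    apply/eqP; have /eqP := sz; rewrite /= eq_sym => /eqP/card0_eq/(_ s).
    by rewrite !inE => /negbFE.
  rewrite ifT; last by apply/forallP => g; rewrite /content eq_card0 // => s; rewrite !inE b0.
  by rewrite trace_form_id big1 ?ltr01 // => s _; apply: AN.
rewrite [place_prod _]/= trace_form_place_sum (bigID (fun s => b s == Some g)) /=.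
(* Placing [X g] where the label is not [g] leaves every labelled place traceless, by duality at [s]
   and by [tr_Z] elsewhere; the remaining factors are then too few. *)
rewrite [X in _ + X]big1 ?addr0 => [|s bs]; last first.
  apply: trace_form_prod_eq0; rewrite [X in (X <= _)%N]sz.
  apply/subset_leq_card/subsetP => t; rewrite !inE /mulr_at => bt.
  have [ts|ts] := eqVneq t s.
    move: bs (AS s) bt; rewrite ts; case: (b s) => // h.
    rewrite (inj_eq Some_inj) => /negPf hg /(_ h erefl) -> _.
    by rewrite tr_dual hg.
  by have := AS t; case: (b t) bt => // h _ /(_ h erefl) ->; rewrite tr_Z.
(* A place matched with [g] loses its label, since its factor now has trace one. *)
pose b' s t := if t == s then None else b t.
have content' s h : b s = Some g -> content b h = ((h == g) + content (b' s) h)%N.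
  move=> bs; rewrite /content (cardD1 s) !inE bs (inj_eq Some_inj) eq_sym.
  congr (_ + _)%N; apply: eq_card => t; rewrite !inE /b'.
  by case: (t =P s).
have IHs s : b s == Some g ->
    if [forall h, content (b' s) h == count_mem h gs]
    then is_true (0 < trace_form (mulr_at A s (X g)) (place_prod gs))
    else trace_form (mulr_at A s (X g)) (place_prod gs) = 0.
  move=> /eqP bs; apply: IH.
  - by move=> t h; rewrite /b' /mulr_at; case: (t =P s) => // _; apply: AS.
  - move=> t; rewrite /b' /mulr_at; case: (t =P s) => [_ _|_]; last exact: AN.
    by rewrite (AS _ _ bs) tr_dual eqxx.
  - apply: succn_inj; rewrite [LHS]sz (cardD1 s) !inE bs /=; congr _.+1.
    by apply: eq_card => t; rewrite !inE /b'; case: (t =P s).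
have allE s : b s = Some g -> [forall h, content (b' s) h == count_mem h gs] =
    [forall h, content b h == count_mem h (g :: gs)].
  move=> bs; apply: eq_forallb => h.
  by rewrite (content' s) //= [g == h]eq_sym eqn_add2l.
case: ifP => [cnt|cnt].
  have /card_gt0P[s bs] : (0 < content b g)%N.
    by rewrite (eqP (forallP cnt g)) /= eqxx.
  rewrite (bigD1 s) //= ltr_wpDr //; last first.
    by have := IHs s bs; rewrite allE ?cnt //; apply/eqP.
  apply: sumr_ge0 => t /andP[bt _]; apply: ltW.
  by have := IHs t bt; rewrite allE ?cnt //; apply/eqP.
rewrite big1 // => s bs.
by have := IHs s bs; rewrite allE ?cnt //; apply/eqP.
Qed.

(** A longest word with nonzero coefficient is isolated by the form whose labels are its letters:
    the form is positive on it and kills every other term. *)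
Lemma place_prods_independent (M : finType) (P : pred M) (word : M -> seq G)
    (c : M -> K) (A0 : 'M[K]_n) :
  \tr A0 = 1 ->
  (forall m, P m -> (size (word m) <= d)%N) ->
  (forall m m', (forall g, count_mem g (word m) = count_mem g (word m')) -> m = m') ->
  \sum_(m | P m) c m *: place_prod (word m) = 0 ->
  forall m, P m -> c m = 0.
Proof.
move=> trA0 wd winj sum0 m1 Pm1; apply/eqP; apply: contraT => cm1.
have := @arg_maxnP _ m1 (fun m => P m && (c m != 0)) (fun m => size (word m)).
rewrite Pm1 cm1 => /(_ isT) [m /andP[Pm cm] maxm].
(* The labels are the letters of the word padded with [None] up to [d] places, which is where the
   bound on the length enters. *)
have szL : size (map Some (word m) ++ nseq (d - size (word m)) None) == d.
  by rewrite size_cat size_map size_nseq subnKC ?wd.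
pose L := Tuple szL; pose b := tnth L.
have countL x : #|[pred s | b s == x]| = count_mem x L.
  rewrite -[in RHS](map_tnth_enum L) count_map cardE size_filter.
  by rewrite [in RHS]/enum_mem count_filter; apply: eq_count => s; rewrite !inE andbT.
have contentL g : content b g = count_mem g (word m).
  rewrite /content countL count_cat count_map count_nseq mul0n addn0.
  by apply: eq_count.
have suppL : #|[pred s | b s != None]| = size (word m).
  apply/eqP; rewrite -(eqn_add2l #|[pred s | b s == None]|) cardC card_ord countL.
  rewrite count_cat count_map count_nseq mul1n (eq_count (a2 := pred0)) // count_pred0.
  by rewrite add0n subnK ?wd.
pose A s := if b s is Some g then Z g else A0.
have AS s g : b s = Some g -> A s = Z g by rewrite /A => ->.
have AN s : b s = None -> \tr (A s) = 1 by rewrite /A => ->.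
have : trace_form A (\sum_(m | P m) c m *: place_prod (word m)) = 0.
  by rewrite sum0 -(scale0r (\1%VF : End)) trace_formZ mul0r.
rewrite trace_form_sum (bigD1 m) //= big1 ?addr0 => [|m' /andP[Pm' m'm]].
  rewrite trace_formZ => /eqP; rewrite mulf_eq0 (negPf cm) /=.
  have := trace_form_prod AS AN (esym suppL); rewrite ifT => [/gt_eqF ->//|].
  by apply/forallP => g; rewrite contentL.
rewrite trace_formZ; have [->|cm'] := eqVneq (c m') 0; first by rewrite mul0r.
(* By maximality the other word is not longer. If it has equal length its content differs; if it is
   shorter, the form has too many traceless factors. *)
have := maxm m'; rewrite Pm' cm' => /(_ isT); rewrite /= leq_eqVlt => /orP[/eqP sz|lt].
  have := trace_form_prod AS AN (etrans sz (esym suppL)); rewrite ifF => [->|].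
    by rewrite mulr0.
  apply: contraNF m'm => /forallP cnt; apply/eqP/winj => g.
  by rewrite -(eqP (cnt g)) contentL.
rewrite trace_form_prod_eq0 ?mulr0 // (leq_trans lt) // -suppL.
apply/subset_leq_card/subsetP => s; rewrite !inE => bs.
by case bsE: (b s) bs => [g|//] _; rewrite (AS _ _ bsE) tr_Z.
Qed.

End PlaceSums.

(** * The classical limit of the generators *)

Section OrderedMonomials.
Variables (K : fieldType) (W : vectType K) (G : eqType).
Implicit Types (x y : G -> 'End(W)) (s : seq G) (m : G -> nat) (f : 'End(W)).

(** [monomial] for an arbitrary family of operators and list of slots, so that generators can be
    exchanged and specialised. *)
Definition ordered_monomial x s m : 'End(W) :=
  \big[(@comp_lfun K W W W) / \1%VF]_(g <- s) iter (m g) (comp_lfun (x g)) \1%VF.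

Lemma ordered_monomial_cons x g s m :
  ordered_monomial x (g :: s) m =
  (iter (m g) (comp_lfun (x g)) \1 \o ordered_monomial x s m)%VF.
Proof. exact: big_cons. Qed.

(** Expands the k-th power of a f + b between fixed outer factors, one factor at a time: f is
    absorbed into [p], and the constant lowers the exponent. *)
Lemma power_affine (V : {vspace 'End(W)}) f f' p q a b k :
  f' = a *: f + b *: \1%VF ->
  (forall j, (j <= k)%N -> (p \o (iter j (comp_lfun f) \1 \o q))%VF \in V) ->
  (p \o (iter k (comp_lfun f') \1 \o q))%VF \in V.
Proof.
move=> f'E; elim: k p => [|k IH] p Vp; first exact: (Vp 0%N).
rewrite iterS -comp_lfunA {1}f'E comp_lfunDl -!comp_lfunZl comp_lfun1l.
rewrite comp_lfunDr -!comp_lfunZr memvD ?memvZ // ?IH //.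
  rewrite comp_lfunA; apply: IH => j jk.
  by rewrite -comp_lfunA [(f \o (_ \o _))%VF]comp_lfunA -iterS Vp.
by move=> j jk; apply/Vp/leqW.
Qed.

(** The slots are expanded in turn without being permuted, so no commutation relation enters, and
    exponents only decrease. *)
Lemma ordered_monomial_affine (V : {vspace 'End(W)}) x y (a b : G -> K) s m p :
  (forall g, y g = a g *: x g + b g *: \1%VF) -> uniq s ->
  (forall m', (forall g, m' g <= m g)%N -> (p \o ordered_monomial x s m')%VF \in V) ->
  (p \o ordered_monomial y s m)%VF \in V.
Proof.
move=> yE; elim: s p => [|g s IH] p; first by move=> _ /(_ m); rewrite /ordered_monomial !big_nil; apply.
move=> /= /andP[gs us] Vp; rewrite ordered_monomial_cons.
apply: (power_affine (yE g)) => j jm; rewrite comp_lfunA; apply: IH => // m' m'm.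
(* The first slot takes exponent [j]; by [uniq], [g] does not recur, so the tail is unaffected. *)
pose m'' h := if h == g then j else m' h.
have /Vp : forall h, (m'' h <= m h)%N by rewrite /m'' => h; case: eqP => [->|].
rewrite ordered_monomial_cons {1}/m'' eqxx comp_lfunA; congr (_ \o _ \in V)%VF.
rewrite /ordered_monomial [LHS]big_seq [RHS]big_seq; apply: eq_bigr => h hs.
by rewrite /m'' ifN //; apply: contraNneq gs => <-.
Qed.

End OrderedMonomials.

(** * Limits at v = 1 of the root vectors and of the Cartan part *)

Section ClassicalLimit.
Variables (n d : nat).
Local Notation EndQv := 'End(tensor Qv n d).
Local Notation EndQ := 'End(tensor rat n d).

Definition spec_mx (A : 'M[Qv]_n) (B : 'M[rat]_n) := forall a b, spec (A a b) (B a b).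

Definition spec_op (f : EndQv) (g : EndQ) :=
  forall u w, spec (coef f u w) (coef g u w).

Lemma spec_bool (b : bool) : spec b%:R b%:R.
Proof. exact: spec_nat. Qed.

Lemma spec_mx1 : spec_mx 1%:M 1%:M.
Proof. by move=> a b; rewrite !mxE; apply: spec_bool. Qed.

Lemma spec_mxM A B A' B' : spec_mx A A' -> spec_mx B B' -> spec_mx (A *m B) (A' *m B').
Proof. by move=> AA BB a b; rewrite !mxE; apply: spec_sum => c _; apply: specM. Qed.

Lemma spec_op_id : spec_op \1%VF \1%VF.
Proof. by move=> u w; rewrite !coef_id; apply: spec_bool. Qed.

Lemma spec_op_comp f g f' g' :
  spec_op f f' -> spec_op g g' -> spec_op (f \o g)%VF (f' \o g')%VF.
Proof. by move=> ff gg u w; rewrite !coef_comp; apply: spec_sum => t _; apply: specM. Qed.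

Lemma spec_op_sum (I : Type) (r : seq I) (P : pred I) (F : I -> EndQv) (F' : I -> EndQ) :
  (forall i, P i -> spec_op (F i) (F' i)) ->
  spec_op (\sum_(i <- r | P i) F i) (\sum_(i <- r | P i) F' i).
Proof. by move=> FF u w; rewrite !coef_sum; apply: spec_sum => i Pi; apply: FF. Qed.

Lemma spec_op_scale f f' a a' : spec a a' -> spec_op f f' -> spec_op (a *: f) (a' *: f').
Proof. by move=> aa ff u w; rewrite !coefZ; apply: specM. Qed.

Lemma spec_op_sub f g f' g' :
  spec_op f f' -> spec_op g g' -> spec_op (f - g) (f' - g').
Proof. by move=> ff gg u w; rewrite !coefB; apply: specD => //; apply: specN. Qed.

Lemma spec_op_qbracket q q' f g f' g' : spec q q' ->
  spec_op f f' -> spec_op g g' -> spec_op (qbracket q f g) (qbracket q' f' g').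
Proof.
by move=> qq ff gg; apply: spec_op_sub; last apply: spec_op_scale; try exact: spec_op_comp.
Qed.

Lemma spec_tensor_op (f : 'I_d -> 'M[Qv]_n) (f' : 'I_d -> 'M[rat]_n) :
  (forall s, spec_mx (f s) (f' s)) -> spec_op (tensor_op f) (tensor_op f').
Proof.
by move=> ff u w; rewrite !coef_tensor_op; apply: spec_prod => s _; apply: ff.
Qed.

Lemma spec_natE i : spec_mx (natE Qv n i) (natE rat n i).
Proof. by move=> a b; rewrite !mxE; apply: spec_bool. Qed.

Lemma spec_natF i : spec_mx (natF Qv n i) (natF rat n i).
Proof. by move=> a b; rewrite !mxE; apply: spec_bool. Qed.

Lemma spec_natK i : spec_mx (natK n indet i) 1%:M.
Proof.
move=> a b; rewrite !mxE; case: (a == b); last exact: (spec_nat 0).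
by case: ifP => _; [exact: spec_indet | exact: (spec_nat 1)].
Qed.

Lemma spec_natKV i : spec_mx (natKV n indet i) 1%:M.
Proof.
move=> a b; rewrite !mxE; case: (a == b); last exact: (spec_nat 0).
by case: ifP => _; [exact: spec_indetV | exact: (spec_nat 1)].
Qed.

(** The factors K_i K_(i+1)^-1 of the coproduct tend to the identity. *)
Lemma spec_opE i : spec_op (opE n d indet i) (place_sum d (natE rat n i)).
Proof.
apply: spec_op_sum => r _; apply: spec_tensor_op => s.
case: ltngtP => [sr|rs|/val_inj ->]; last by rewrite eqxx; apply: spec_natE.
  by rewrite -val_eqE (ltn_eqF sr); apply: spec_mx1.
rewrite -val_eqE (gtn_eqF rs) -[1%:M]mulmx1.
exact: spec_mxM (spec_natK _) (spec_natKV _).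
Qed.

Lemma spec_opF i : spec_op (opF n d indet i) (place_sum d (natF rat n i)).
Proof.
apply: spec_op_sum => r _; apply: spec_tensor_op => s.
case: ltngtP => [sr|rs|/val_inj ->]; last by rewrite eqxx; apply: spec_natF.
  rewrite -val_eqE (ltn_eqF sr) -[1%:M]mulmx1.
  exact: spec_mxM (spec_natKV _) (spec_natK _).
by rewrite -val_eqE (gtn_eqF rs); apply: spec_mx1.
Qed.

Definition nat_delta i j : 'M[rat]_n := \matrix_(a, b) ((a == i :> nat) && (b == j :> nat))%:R.

Lemma coef_place (s : 'I_d) (A : 'M[rat]_n) u w :
  coef (place s A) u w = A (u s) (w s) * \prod_(t | t != s) (u t == w t)%:R.
Proof.
rewrite coef_tensor_op (bigD1 s) //= eqxx; congr (_ * _).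
by apply: eq_bigr => t /negPf ->; rewrite mxE.
Qed.

Lemma placeB (s : 'I_d) (A B : 'M[rat]_n) : place s (A - B) =  place s A - place s B.
Proof. by apply: coef_inj => u w; rewrite coefB !coef_place !mxE mulrBl. Qed.

Lemma place_comp_eq (s : 'I_d) (A B : 'M[rat]_n) : (place s A \o place s B)%VF = place s (A *m B).
Proof.
rewrite tensor_opM; apply: eq_tensor_op => t.
by case: ifP; rewrite ?mulmx1.
Qed.

Lemma place_comp_neq (s t : 'I_d) (A B : 'M[rat]_n) : s != t ->
  (place s A \o place t B = place t B \o place s A)%VF.
Proof.
move=> st; rewrite !tensor_opM; apply: eq_tensor_op => r.
case: (r =P s) => [->|]; first by rewrite (negPf st) mulmx1 mul1mx.
by case: (r =P t) => _ _; rewrite ?mulmx1 ?mul1mx.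
Qed.

Lemma comp_lfun_sum (I : finType) (F F' : I -> EndQ) :
  ((\sum_i F i) \o (\sum_j F' j) = \sum_i \sum_j (F i \o F' j))%VF.
Proof.
apply/lfunP => x; rewrite comp_lfunE !sum_lfunE; apply: eq_bigr => r _.
by rewrite sum_lfunE linear_sum; apply: eq_bigr => t _; rewrite comp_lfunE.
Qed.

(** Operators at different places commute, so only the brackets at equal places survive. *)
Lemma qbracket_place_sum (A B : 'M[rat]_n) :
  qbracket 1 (place_sum d A) (place_sum d B) = place_sum d (A *m B - B *m A).
Proof.
rewrite /qbracket scale1r /place_sum !comp_lfun_sum.
rewrite [X in _ - X]exchange_big /= -sumrB; apply: eq_bigr => s _.
rewrite -sumrB (bigD1 s) //= big1 ?addr0 => [|t ts].
  by rewrite !place_comp_eq placeB.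
by rewrite place_comp_neq 1?eq_sym // subrr.
Qed.

Lemma nat_deltaM i j k l : (j < n)%N -> 
  nat_delta i j *m nat_delta k l = (j == k)%:R *: nat_delta i l.
Proof.
move=> jn; apply/matrixP => a b; rewrite !mxE (bigD1 (Ordinal jn)) //= big1 => [|c].
  rewrite !mxE /= eqxx andbT addr0; by case: (a == i :> nat); case: (j == k) => /=; ring.
by rewrite -val_eqE /= !mxE => /negPf ->; rewrite andbF mul0r.
Qed.

(** At v = 1 the recursion is the commutator of two adjacent matrix units, of which one product is
    the next unit and the other is zero. *)
Lemma spec_rootE_rec i l : ((i + l).+1 < n)%N ->
  spec_op (rootE_rec n d indet i l) (place_sum d (nat_delta i (i + l).+1)).
Proof.
elim: l i => [|l IH] i iln; first by rewrite addn0; apply: spec_opE.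
have := spec_op_qbracket spec_indet (spec_opE i) (IH i.+1 _).
rewrite qbracket_place_sum addSnnS => /(_ iln); congr (spec_op _ (place_sum d _)).
rewrite -/(nat_delta i i.+1) !nat_deltaM //; last by lia.
by rewrite eqxx scale1r gtn_eqF ?scale0r ?subr0 //; lia.
Qed.

Lemma spec_rootF_rec i l : ((i + l).+1 < n)%N ->
  spec_op (rootF_rec n d indet i l) (place_sum d (nat_delta (i + l).+1 i)).
Proof.
elim: l i => [|l IH] i iln; first by rewrite addn0; apply: spec_opF.
have := spec_op_qbracket spec_indetV (IH i.+1 _) (spec_opF i).
rewrite qbracket_place_sum addSnnS => /(_ iln); congr (spec_op _ (place_sum d _)).
rewrite -/(nat_delta i.+1 i) !nat_deltaM //; try by lia.
by rewrite eqxx scale1r ltn_eqF ?scale0r ?subr0 //; lia.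
Qed.

(** First-order data at v = 1: value 1 and derivative [b]. *)
Definition tangent (x : Qv) (b : rat) := spec x 1 /\ spec ((indet - 1)^-1 * (x - 1)) b.

(** Leibniz rule, from x y - 1 = (x - 1) y + (y - 1). *)
Lemma tangent_prod (I : Type) (r : seq I) (x : I -> Qv) (b : I -> rat) :
  (forall i, tangent (x i) (b i)) -> tangent (\prod_(i <- r) x i) (\sum_(i <- r) b i).
Proof.
move=> xb; elim/big_rec2: _ => [|i b1 x1 _ [x11 x1b]].
  by split; [exact: (spec_nat 1) | rewrite subrr mulr0; exact: (spec_nat 0)].
have [xi1 xib] := xb i; split; first by rewrite -[1]mulr1; apply: specM.
have := specD (specM xib x11) x1b; rewrite mulr1; congr spec; ring.
Qed.

Lemma indet_neq1 : indet != 1.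
Proof.
rewrite -[1]tofrac1 tofrac_eq; apply/negP => /eqP /(congr1 (horner^~ 0)).
by rewrite hornerX hornerC => /eqP; rewrite eq_sym oner_eq0.
Qed.

Lemma indet_neq0 : indet != 0.
Proof. by rewrite tofrac_eq0 polyX_eq0. Qed.

Definition opL i : EndQv := (indet - 1)^-1 *: (opK n d indet i - \1%VF).

(** K_i is diagonal on words, with entry v to the number of letters i; the derivative of this entry
    at 1 is that number. *)
Lemma spec_opL i : spec_op (opL i) (place_sum d (nat_delta i i)).
Proof.
move=> u w; rewrite /place_sum coef_sum coefZ coefB.
have idE (K : fieldType) : (u == w)%:R = \prod_t (u t == w t)%:R :> K.
  case: eqP => [->|uw]; first by rewrite big1 // => t _; rewrite eqxx.
  case: (pickP (fun t => u t != w t)) => [t /negPf tt|all0].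
    by rewrite (bigD1 t) //= tt mul0r.
  by case: uw; apply/ffunP => t; apply/eqP/negbFE/all0.
have -> : coef (opK n d indet i) u w =
    (\prod_t (if u t == i :> nat then indet else 1)) * (u == w)%:R.
  rewrite coef_tensor_op idE -big_split; apply: eq_bigr => t _.
  by rewrite !mxE /= mulr_natr.
rewrite coef_id.
have -> : \sum_s coef (place s (nat_delta i i)) u w =
    (\sum_s (u s == i :> nat)%:R) * (u == w)%:R.
  rewrite mulr_suml; apply: eq_bigr => s _; rewrite coef_place idE [in RHS](bigD1 s) //=.
  rewrite mulrA mxE; congr (_ * _). case: (u s =P w s) => [->|uw]; rewrite ?andbb ?mulr1 //.
  rewrite mulr0; case: eqP => //= ui; case: eqP => // wi.
  by case: uw; apply: val_inj; rewrite /= ui wi.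
rewrite -[X in _ * _ - X]mul1r -mulrBl mulrA; apply: specM (spec_bool _).
apply: (tangent_prod _ _).2 => t; rewrite /tangent.
case: (_ == _); split; rewrite ?subrr ?mulr0 ?mulVf ?subr_eq0 ?indet_neq1 //.
- exact: spec_indet.
- exact: (spec_nat 1).
- exact: (spec_nat 1).
- exact: (spec_nat 0).
Qed.

End ClassicalLimit.

(** * Upper bound on the dimension *)

Section Invariants.
Variables (K : fieldType) (n d : nat).
Implicit Types (f : 'End(tensor K n d)) (u w : word n d).

Definition permw (p : {perm 'I_d}) w : word n d := [ffun t => w (p t)].

Definition perm_invariant f (p : {perm 'I_d}) :=
  forall u w, coef f (permw p u) (permw p w) = coef f u w.

Lemma perm_invariantM f p q :
  perm_invariant f p -> perm_invariant f q -> perm_invariant f (p * q)%g.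
Proof.
move=> fp fq u w; rewrite -[RHS]fq -[RHS]fp.
by congr coef; apply/ffunP => t; rewrite !ffunE permM.
Qed.

(** Adjacent transpositions generate the symmetric group. *)
Lemma perm_invariant_all f :
  (forall r s : 'I_d, s = r.+1 :> nat -> perm_invariant f (tperm r s)) ->
  forall p, perm_invariant f p.
Proof.
move=> fadj.
have ftlt k (i j : 'I_d) : j = (i + k).+1 :> nat -> perm_invariant f (tperm i j).
  elim: k j => [|k IH] j jE; first by apply: fadj; rewrite jE addn0.
  have ltd : ((i + k).+1 < d)%N by have := ltn_ord j; lia.
  (* [h] is the place just before [j]: conjugating the transposition of i and h by that of h and j
     gives the one of i and j. *)
  pose h := Ordinal ltd; have fh := fadj h j; have fi := IH h erefl.
  have -> : tperm i j = (tperm h j * (tperm i h * tperm h j))%g.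
    rewrite -[X in (X * _)%g]tpermV -/(conjg _ _) tpermJ tpermL tpermD //.
      by rewrite -val_eqE /=; lia.
    by rewrite -val_eqE /=; lia.
  have fhj : perm_invariant f (tperm h j) by apply: fh; rewrite /= jE addnS.
  exact: perm_invariantM fhj (perm_invariantM fi fhj).
move=> p; have [ts -> _] := prod_tpermP p.
have f1 : perm_invariant f 1%g.
  by move=> u w; congr coef; apply/ffunP => t; rewrite ffunE perm1.
elim/big_rec: _ => // [[i j]] q _ fq; apply: perm_invariantM => //=.
case: (ltngtP i j) => [ij|ji|/val_inj ->].
- by apply: (ftlt (j - i).-1); lia.
- by rewrite tpermC; apply: (ftlt (i - j).-1); lia.
by rewrite tperm1.
Qed.

Definition pair_count u w (p : 'I_n * 'I_n) := #|[pred s | (u s, w s) == p]|.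

Lemma sum_pair_count u w : (\sum_p pair_count u w p)%N = d.
Proof.
rewrite -[RHS]card_ord -sum1_card (partition_big (fun s => (u s, w s)) predT) //=.
by apply: eq_bigr => p _; rewrite /pair_count -sum1_card.
Qed.

(** The multiplicity of (k0,k0) is recovered from the total [d]. Two tuples of pairs with the same
    multiplicities are then permutations of each other. *)
Lemma same_pair_count k0 u w u' w' :
  (forall p, p != (k0, k0) -> pair_count u w p = pair_count u' w' p) ->
  exists p, u = permw p u' /\ w = permw p w'.
Proof.
move=> same.
have {}same p : pair_count u w p = pair_count u' w' p.
  have [->|/same //] := eqVneq p (k0, k0).
  have := etrans (sum_pair_count u w) (esym (sum_pair_count u' w')).
  rewrite (bigD1 (k0, k0)) //= [RHS](bigD1 (k0, k0)) //=.
  by rewrite (eq_bigr _ same) => /addIn.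
have countE (x y : word n d) p :
    count_mem p [tuple (x s, y s) | s < d] = pair_count x y p.
  rewrite count_map /pair_count cardE size_filter /= enumT.
  by apply: eq_count => s; rewrite !inE.
have /tuple_permP[p eqp] :
    perm_eq [tuple (u s, w s) | s < d] [tuple (u' s, w' s) | s < d].
  by apply/allP => p _ /=; rewrite !countE same.
have uwE s : (u s, w s) = (u' (p s), w' (p s)).
  have := congr1 (fun x => nth (u s, w s) x s) eqp.
  by rewrite -!tnth_nth !tnth_mktuple.
by exists p; split; apply/ffunP => s; rewrite ffunE; case: (uwE s).
Qed.

End Invariants.

(** * Orbits of pairs of words and the dimension of S(n,d) *)

Section UpperBound.
Variables (n d : nat) (k0 : 'I_n).
Implicit Types (u w : word n d).

(** As v - v^-1 vanishes at v = 1, T_r becomes the swap of two places. *)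
Lemma spec_hecke_formula (a b : 'I_n) x y x' y' : spec x x' -> spec y y' ->
  spec (hecke_formula indet a b x y) (if a == b then x' else y').
Proof.
rewrite /hecke_formula => xx yy; case: ifP => _.
  by rewrite -[x']mul1r; apply: specM spec_indet xx.
rewrite -[y']addr0; apply: specD => //.
have := specM (specM (spec_nat (b < a)) (specD spec_indet (specN spec_indetV))) xx.
by rewrite subrr mulr0 mul0r.
Qed.

Lemma spec_qSchur_invariant f (g : 'End(tensor rat n d)) :
  f \in qSchur n d indet -> spec_op f g -> forall p, perm_invariant g p.
Proof.
move=> /qSchurP fS fg; apply: perm_invariant_all => r s rs u w.
have swapE (x : word n d) : permw (tperm r s) x = swap r s x by [].
have move_swap x y : coef g (swap r s x) y = coef g x (swap r s y).
  have := congr1 (fun h => coef h x y) (fS r s rs).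
  rewrite coef_heckeT_comp coef_comp_heckeT => e.
  have := spec_hecke_formula (x r) (x s) (fg x y) (fg (swap r s x) y).
  rewrite e => /spec_unique/(_ (spec_hecke_formula (y r) (y s) (fg x y) (fg x (swap r s y)))).
  (* A word with equal letters at the two places is fixed by the swap, so all four cases say the
     same. *)
  case: eqP => [xrs|_]; case: eqP => [yrs|_] //.
  - by rewrite (swap_id xrs) (swap_id yrs).
  - by rewrite (swap_id xrs).
  by rewrite (swap_id yrs).
by rewrite !swapE move_swap swapK.
Qed.

Definition exponents (m : {ffun gidx k0 -> 'I_d.+1}) := (\sum_g m g <= d)%N.

(** The label of the orbit of a pair of words; [inord] loses nothing because a count is at most
    [d]. *)
Definition pair_exponent (x : word n d * word n d) : {ffun gidx k0 -> 'I_d.+1} :=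
  [ffun g => inord (pair_count x.1 x.2 (val g))].

Lemma pair_exponentE x g : pair_exponent x g = pair_count x.1 x.2 (val g) :> nat.
Proof. by rewrite ffunE inordK // ltnS -[leqRHS]card_ord max_card. Qed.

(** Each place contributes to at most one exponent. *)
Lemma pair_exponent_le x : exponents (pair_exponent x).
Proof.
rewrite /exponents (eq_bigr _ (fun g _ => pair_exponentE x g)).
rewrite (eq_bigr (fun g : gidx k0 => (\sum_s ((x.1 s, x.2 s) == val g))%N)); last first.
  by move=> g _; rewrite /pair_count -sum1_card big_mkcond.
rewrite exchange_big -[leqRHS]card_ord -sum1_card leq_sum // => s _.
rewrite -big_mkcond sum1_card.
by apply/card_le1_eqP => g h /(eqP (x := (_, _))) gs /(eqP (x := (_, _))) hs; apply: val_inj; rewrite -gs -hs.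
Qed.

(** Evaluation at one pair of words per orbit is injective on S(n,d): a nonzero kernel element would
    rescale to a nonzero invariant operator at v = 1 vanishing on every orbit. *)
Lemma dim_qSchur_le : (\dim (qSchur n d indet) <= #|exponents|)%N.
Proof.
pose rep (i : 'I_#|exponents|) := [pick x | pair_exponent x == enum_val i].
pose ev (f : 'End(tensor Qv n d)) : 'rV[Qv]_#|exponents| :=
  \row_i (if rep i is Some x then coef f x.1 x.2 else 0).
have ev_lin : linear ev.
  move=> a f g; apply/rowP => i; rewrite !mxE; case: (rep i) => [x|].
    by rewrite coefD coefZ.
  by rewrite mulr0 addr0.
pose evL : {linear _ -> _} := HB.pack ev (GRing.isLinear.Build _ _ _ _ ev ev_lin).
rewrite -(limg_ker_dim (linfun evL)).
have -> : (qSchur n d indet :&: lker (linfun evL) = 0)%VS.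
  apply/eqP; rewrite -subv0; apply/subvP => f /memv_capP[fS].
  rewrite memv_ker lfunE /= => /eqP ev0; rewrite memv0; apply: contraT => f0.
  have [x fx] : exists x : word n d * word n d, coef f x.1 x.2 != 0.
    apply/existsP; apply: contraNT f0; rewrite negb_exists => /forallP all0.
    apply/eqP/coef_inj => u w; have := all0 (u, w); rewrite negbK => /eqP /= ->.
    by rewrite /coef zero_lfunE ffunE.
  (* [y] is a pair of words at which the rescaled limit does not vanish. *)
  have [c [a [spec_a [y ay]]]] := spec_scale (ex_intro (fun x => coef f x.1 x.2 != 0) x fx).
  pose g : 'End(tensor rat n d) := extend (fun w => [ffun u => a (u, w)]).
  have gE u w : coef g u w = a (u, w) by rewrite /coef extendE ffunE.
  have cfg : spec_op (c *: f) g by move=> u w; rewrite coefZ gE; apply: (spec_a (u, w)).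
  have gsym := spec_qSchur_invariant (memvZ c fS) cfg.
  case/eqP: ay; rewrite [y]surjective_pairing -gE.
  pose i := enum_rank_in (pair_exponent_le y) (pair_exponent y).
  have iE : enum_val i = pair_exponent y by rewrite enum_rankK_in //; apply: pair_exponent_le.
  have := congr1 (fun r : 'rV_ _ => r 0 i) ev0; rewrite !mxE /rep iE.
  case: pickP => [z /eqP zy fz|/(_ y)]; last by rewrite eqxx.
  have [p np|p [-> ->]] := @same_pair_count n d k0 y.1 y.2 z.1 z.2.
    by rewrite -(pair_exponentE z (Sub p np)) zy pair_exponentE.
  (* [y] lies in the orbit of the representative [z], where the coefficient of [f] is zero. *)
  rewrite gsym; apply: (spec_unique (cfg _ _)); rewrite coefZ fz mulr0.
  exact: (spec_nat 0).
rewrite dimv0 add0n (leq_trans (dimvS (subvf _))) // dimvf dim_matrix mul1r.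
exact: leqnn.
Qed.

End UpperBound.

(** * The basis theorem *)

Lemma free_image (K : fieldType) (V : vectType K) (I : finType) (P : pred I) (F : I -> V) :
  (forall c : I -> K, \sum_(i | P i) c i *: F i = 0 -> forall i, P i -> c i = 0) ->
  free (image F P).
Proof.
move=> indep; apply/(@freeP _ _ _ [tuple of image F P]) => k k0 j.
(* Transports coefficients from positions in the enumeration to [I], with 0 outside [P]. *)
pose c i := if [pick j | enum_val j == i] is Some j then k j else 0.
have cE l : c (enum_val l) = k l.
  rewrite /c; case: pickP => [l' /eqP/enum_val_inj -> //|/(_ l)].
  by rewrite eqxx.
rewrite -cE; apply: indep; last exact: enum_valP.
rewrite -[RHS]k0 (big_enum_val _ (A := P)); apply: eq_bigr => l _.
by rewrite cE nth_image.
Qed.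

Section PlaceProducts.
Variables (K : numFieldType) (n d : nat) (G : finType) (X : G -> 'M[K]_n).

(** Spells a monomial as a list of single factors, the form taken by [place_prod]. *)
Definition exponent_word (s : seq G) (m : G -> nat) := flatten [seq nseq (m g) g | g <- s].

Lemma place_prod_ordered s m :
  place_prod d X (exponent_word s m) =
  ordered_monomial (fun g => place_sum d (X g)) s m.
Proof.
elim: s => [|g s IH]; first by rewrite /ordered_monomial big_nil.
rewrite ordered_monomial_cons -IH /exponent_word /=.
elim: (m g) => [|k IHk] /=; first by rewrite comp_lfun1l.
by rewrite IHk comp_lfunA.
Qed.

Lemma count_exponent_word s m g : uniq s -> g \in s ->
  count_mem g (exponent_word s m) = m g.
Proof.
rewrite /exponent_word => us gs; rewrite count_flatten -map_comp sumnE big_map.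
rewrite (bigD1_seq g) //= count_nseq /= eqxx mul1n big1 ?addn0 // => h hg.
by rewrite count_nseq /= (negPf hg) mul0n.
Qed.

Lemma size_exponent_word s m : size (exponent_word s m) = \sum_(g <- s) m g.
Proof.
rewrite /exponent_word size_flatten /shape -map_comp sumnE big_map.
by apply: eq_bigr => g _; rewrite /= size_nseq.
Qed.

End PlaceProducts.

(** * Trace-dual matrices and freeness of the modified monomials *)

Section Generators.
Variables (n d : nat) (k0 : 'I_n).
Implicit Types g h : gidx k0.

Definition unit_mx g : 'M[rat]_n := delta_mx (val g).1 (val g).2.

(** The transposed unit, made traceless in the diagonal case by subtracting e_(k0,k0), which pairs
    to zero with every [unit_mx] because (k0,k0) is excluded. *)
Definition dual_mx g : 'M[rat]_n :=
  delta_mx (val g).2 (val g).1 - delta_mx k0 k0 *+ ((val g).1 == (val g).2).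

Lemma mxtrace_delta (i j : 'I_n) : \tr (delta_mx i j : 'M[rat]_n) = (i == j)%:R.
Proof.
rewrite /mxtrace (bigD1 i) //= mxE eqxx /= big1 ?addr0 // => l.
by rewrite mxE => /negPf ->.
Qed.

Lemma mxtrace_dual g : \tr (dual_mx g) = 0.
Proof.
rewrite linearB linearMn /= !mxtrace_delta eqxx eq_sym.
by case: eqP; rewrite ?mulr1n ?mulr0n subrr.
Qed.

Lemma mxtrace_dual_mul g h : \tr (dual_mx g *m unit_mx h) = (g == h)%:R.
Proof.
rewrite mulmxBl linearB /= -scaler_nat -scalemxAl linearZ /= /unit_mx.
rewrite !mul_delta_mx_cond !linearMn /= !mxtrace_delta.
rewrite -[g == h](inj_eq val_inj); case: g h => [[i j] gk] [[a b] hk] /=; rewrite xpair_eqE.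
have -> : (k0 == b)%:R *+ (k0 == a) = 0 :> rat.
  by move: hk; rewrite xpair_eqE ![k0 == _]eq_sym; case: (a == k0); case: (b == k0).
by rewrite mulr0 subr0; case: (i == a); rewrite ?mulr1n ?mulr0n.
Qed.

(* K_k replaced by (K_k - 1)/(v - 1), whose limit at v = 1 is the Cartan element. *)
Definition gen_log g : 'End(tensor Qv n d) :=
  if (val g).1 == (val g).2 then opL n d (val g).1 else gen d indet g.

Lemma spec_gen_log g : spec_op (gen_log g) (place_sum d (unit_mx g)).
Proof.
have <- : nat_delta n (val g).1 (val g).2 = unit_mx g.
  by apply/matrixP => a b; rewrite !mxE !val_eqE.
rewrite /gen_log /gen; case: (val g) => i j /=.
case: eqP => [->|ij]; first exact: spec_opL.
have jn := ltn_ord j; have iN := ltn_ord i.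
case: ltngtP => [lt_ij|lt_ji|/val_inj //].
  have e : (i + (j - i).-1).+1 = j by lia.
  by have := @spec_rootE_rec n d i (j - i).-1; rewrite e; apply.
have e : (j + (i - j).-1).+1 = i by lia.
by have := @spec_rootF_rec n d j (i - j).-1; rewrite e; apply.
Qed.

Lemma gen_log_affine g : gen_log g =
  (if (val g).1 == (val g).2 then (indet - 1)^-1 else 1) *: gen d indet g +
  (if (val g).1 == (val g).2 then - (indet - 1)^-1 else 0) *: \1%VF.
Proof.
rewrite /gen_log /gen; case: (val g) => i j /=; case: eqP => [<-|_].
  by rewrite ltnn /opL scalerBr scaleNr.
by rewrite scale1r scale0r addr0.
Qed.

Lemma spec_ordered_monomial x y s (m : gidx k0 -> nat) :
  (forall g, spec_op (x g) (y g)) ->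
  @spec_op n d (ordered_monomial x s m) (ordered_monomial y s m).
Proof.
move=> xy; elim: s => [|g s IH].
  by rewrite /ordered_monomial !big_nil; apply: spec_op_id.
rewrite !ordered_monomial_cons; apply: spec_op_comp => //.
by elim: (m g) => [|k IHk] /=; [exact: spec_op_id | apply: spec_op_comp].
Qed.

(** A relation over Q(v) rescales to one whose limit at v = 1 has a nonzero coefficient, against the
    independence of products of place sums. *)
Lemma gen_log_monomials_free (s : seq (gidx k0)) : uniq s -> (forall g, g \in s) ->
  free (image (fun m : {ffun gidx k0 -> 'I_d.+1} =>
    ordered_monomial gen_log s (fun g => m g : nat)) (@exponents n d k0)).
Proof.
move=> us sT; apply: free_image => c sum0 m Pm; apply/eqP; apply: contraT => cm.
(* Extension by zero makes the nonzero limit coefficient fall on an admissible exponent. *)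
pose c' m := if exponents m then c m else 0.
have [|e [a [spec_a [m1 am1]]]] := @spec_scale _ c'; first by exists m; rewrite /c' Pm.
case/eqP: am1; case Pm1 : (exponents m1); last first.
  by apply: (spec_unique (spec_a m1)); rewrite /c' Pm1 mulr0; apply: (spec_nat 0).
pose word (m : {ffun gidx k0 -> 'I_d.+1}) := exponent_word s (fun g => m g : nat).
apply: (@place_prods_independent _ n d _ unit_mx dual_mx mxtrace_dual_mul mxtrace_dual
  _ (@exponents n d k0) word a (delta_mx k0 k0)) => //.
- by rewrite mxtrace_delta eqxx.
- move=> m2 Pm2; rewrite size_exponent_word; move: Pm2; rewrite /exponents.
  rewrite -big_enum; congr (_ <= _)%N; apply/perm_big/uniq_perm; rewrite ?enum_uniq //.
  by move=> g; rewrite mem_enum sT.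
- move=> m2 m3 eq23; apply/ffunP => g; apply: val_inj.
  by have := eq23 g; rewrite !count_exponent_word.
apply: coef_inj => u w; rewrite {2}/coef zero_lfunE ffunE.
apply: spec0_unique.
have <- : coef (\sum_(m | exponents m) (e * c' m) *:
    ordered_monomial gen_log s (fun g => m g : nat)) u w = 0.
  rewrite (eq_bigr (fun m => e *: (c m *:
    ordered_monomial gen_log s (fun g => m g : nat)))).
    by rewrite -scaler_sumr sum0 scaler0 /coef zero_lfunE ffunE.
  by move=> m2 Pm2; rewrite /c' Pm2 scalerA.
apply: spec_op_sum => m2 _; apply: spec_op_scale; first exact: spec_a.
rewrite place_prod_ordered; apply: spec_ordered_monomial.
exact: spec_gen_log.
Qed.

End Generators.

Theorem mainTheorem6 (n d : nat) (hn : (0 < n)%N) (hd : (0 < d)%N) (k0 : 'I_n)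
    (le : rel (gidx k0)) (le_total : total le) (le_trans : transitive le)
    (le_anti : antisymmetric le) :
  basis_of (qSchur n d indet) (monomials_le d indet le).
Proof.
pose s := sort le (enum {: gidx k0}).
have us : uniq s by rewrite sort_uniq enum_uniq.
have sT g : g \in s by rewrite mem_sort mem_enum.
have size_mon : size (monomials_le d indet le) = #|@exponents n d k0|.
  by rewrite size_image.
have sub_qSchur : (<<monomials_le d indet le>> <= qSchur n d indet)%VS.
  apply/span_subvP => _ /mapP[m _ ->].
  by apply: monomial_qSchur; apply: indet_neq0.
(* Expanding each (K_k - 1)/(v - 1) gives monomials in G' with smaller or equal exponents, hence
   still of degree at most [d]. *)
have log_sub : (<<image (fun m : {ffun gidx k0 -> 'I_d.+1} =>
    ordered_monomial (@gen_log n d k0) s (fun g => m g : nat)) (@exponents n d k0)>>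
    <= <<monomials_le d indet le>>)%VS.
  apply/span_subvP => _ /mapP[m Pm ->]; rewrite mem_enum in Pm.
  rewrite -[ordered_monomial _ _ _]comp_lfun1l.
  apply: (ordered_monomial_affine (@gen_log_affine n d k0)) => // m' m'm.
  rewrite comp_lfun1l.
  have m'd g : (m' g < d.+1)%N by apply: leq_ltn_trans (m'm g) (ltn_ord _).
  pose m'' : {ffun gidx k0 -> 'I_d.+1} := [ffun g => Ordinal (m'd g)].
  have -> : ordered_monomial (gen d indet (k0 := k0)) s m' =
      monomial d indet le (fun g => m'' g : nat).
    by apply: eq_bigr => g _; rewrite ffunE.
  apply/memv_span/image_f; apply: leq_trans (Pm : is_true (exponents m)).
  by apply: leq_sum => g _; rewrite ffunE /= m'm.
have log_free := gen_log_monomials_free d us sT.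
have dimE := @dim_qSchur_le n d k0.
rewrite basisEdim size_mon.
(* This closes the chain: the number of monomials is at most the dimension of their span, which is
   at most dim S(n,d), itself at most that number. *)
have dim_le : (#|@exponents n d k0| <= \dim <<monomials_le d indet le>>)%N.
  by apply: leq_trans (dimvS log_sub); rewrite (eqP log_free) size_image.
have /eqP -> : <<monomials_le d indet le>>%VS == qSchur n d indet.
  by rewrite eqEdim sub_qSchur (leq_trans dimE).
by rewrite subvv (leq_trans dim_le) ?dimvS.
Qed.
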